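(* Let $G$ be a graph and $H$ a subgraph of $G$ such that $G\searrow^{d}H$. If all vertices in $V(G)\setminus V(H)$ are looped, then $C(G)\searrow^{d}C(H)$. In particular, if $G$ is a reflexive graph and $H$ is a subgraph of $G$, then $G\searrow^{d}H$ implies $C(G)\searrow^{d}C(H)$.
   Context: Graphs are finite, undirected, without parallel edges; loops are allowed; a graph is reflexive if every vertex is looped. $N_G(x)=\{y: y\sim x\}$ is the open neighborhood. A vertex $x$ of $G$ is dismantlable if there is a vertex $a\neq x$ with $N_G(x)\subset N_G(a)$. For a subgraph $H$ of $G$, $G\searrow^{d}H$ means: $H$ is the subgraph of $G$ induced by $V(H)$ and one can write $V(G)\setminus V(H)=\{x_1,\dots,x_k\}$ ($k\ge0$, distinct) so that each $x_i$ is dismantlable in the subgraph of $G$ induced by $V(H)\cup\{x_i,\dots,x_k\}$. A complete subgraph of $G$ is an induced subgraph in which any two distinct vertices are adjacent; it is identified with its vertex set. $C(G)$ is the poset of nonempty complete subgraphs of $G$ ordered by inclusion; for a subgraph $H$ of $G$, $C(H)$ is a subposet of $C(G)$. In a finite poset $P$, an element $p$ is dismantlable if $P_{>p}=\{y\in P:y>p\}$ has a least element or $P_{<p}=\{y\in P:y<p\}$ has a greatest element. For posets, $P\searrow^{d}Q$ means that one can go from $P$ to the subposet $Q$ by successively deleting elements, each dismantlable in the poset from which it is deleted. *)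

(* Defs.v *)
From mathcomp Require Import all_boot all_order.

Set Implicit Arguments.
Unset Strict Implicit.
Unset Printing Implicit Defensive.

Import Order.TTheory.
(* The canonical order on {set T} is inclusion. *)
Export Order.DefaultSetSubsetOrder.

(* Graphs have their vertices in an ambient finite type T, so that a graph and
   its subgraphs have the same type. Loops are allowed. *)
Record graph (T : finType) := Graph {
  vert : {set T};
  adj : rel T;
  adj_sym : symmetric adj;
  adj_vert : forall x y, adj x y -> x \in vert
}.

Section Graphs.
Variable T : finType.
Implicit Types (G H : graph T) (A : {set T}) (x a : T).

Definition subgraph H G : Prop :=
  vert H \subset vert G /\ (forall x y, adj H x y -> adj G x y).

Definition looped G x : bool := adj G x x.

Definition reflexive_graph G : Prop := forall x, x \in vert G -> looped G x.

Definition induced_adj G A : rel T := [rel x y | [&& x \in A, y \in A & adj G x y]].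

Lemma induced_adj_sym G A : symmetric (induced_adj G A).
Proof. by move=> x y; rewrite /induced_adj /= (adj_sym G x y) andbCA. Qed.

Lemma induced_adj_vert G A x y : induced_adj G A x y -> x \in vert G :&: A.
Proof. by case/and3P=> xA _ /adj_vert xG; rewrite inE xG. Qed.

Definition induced G A : graph T :=
  Graph (induced_adj_sym G A) (@induced_adj_vert G A).

(* Equality of graphs up to extensional equality of adjacency. *)
Definition same_graph G H : Prop := vert G = vert H /\ adj G =2 adj H.

Definition nbhd G x : {set T} := [set y | adj G y x].

Definition graph_dismantlable G x : Prop :=
  x \in vert G /\
  exists a, [/\ a \in vert G, a != x & nbhd G x \subset nbhd G a].

(* In a decomposition s = s1 ++ x :: s2, x is some x_i and x :: s2 lists
   x_i, ..., x_k. *)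
Definition graph_dismantles G H : Prop :=
  [/\ subgraph H G, same_graph H (induced G (vert H)) &
   exists s : seq T,
     [/\ uniq s, [set x in s] = vert G :\: vert H &
      forall s1 x s2, s = s1 ++ x :: s2 ->
        graph_dismantlable (induced G (vert H :|: [set y in x :: s2])) x]].

Definition complete_in G A : bool :=
  (A \subset vert G) &&
  [forall x in A, forall y in A, (x != y) ==> adj G x y].

Definition complete_poset G : {set {set T}} :=
  [set A : {set T} | (A != set0) && complete_in G A].

End Graphs.

(* A finite poset is a subset of an ambient finite poset with the induced
   order. *)
Section Posets.
Variables (d : Order.disp_t) (U : finPOrderType d).
Implicit Types (P Q A : {set U}) (p m : U).

Definition upper P p : {set U} := [set y in P | (p < y)%O].
Definition lower P p : {set U} := [set y in P | (y < p)%O].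

Definition has_least A : Prop := exists2 m, m \in A & forall y, y \in A -> (m <= y)%O.
Definition has_greatest A : Prop := exists2 m, m \in A & forall y, y \in A -> (y <= m)%O.

Definition poset_dismantlable P p : Prop :=
  p \in P /\ (has_least (upper P p) \/ has_greatest (lower P p)).

Inductive poset_dismantles : {set U} -> {set U} -> Prop :=
| poset_dismantles_refl Q : poset_dismantles Q Q
| poset_dismantles_step P Q p :
    poset_dismantlable P p -> poset_dismantles (P :\ p) Q ->
    poset_dismantles P Q.

End Posets.

(* Main.v *)
Require Import Defs.
From mathcomp Require Import all_boot all_order.

(** If [x] is dominated by [a] and [x] is looped, then [x \in nbhd G x], which
    lies in [nbhd G a], so [a] and [x] are adjacent; hence a complete subgraph
    containing [x] stays complete when [a] is added. This makes the complete
    subgraphs through [x] removable in two sweeps. First those that avoid [a]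
    are deleted from the largest down: when [K] is reached, everything left
    strictly above [K] contains [a], so [a |: K] is the least element above
    [K]. Then those that contain [a] are deleted from the smallest up: when [K]
    is reached, everything left strictly below [K] avoids [x], so [K :\ x] is
    the greatest element below [K] ([poset_dismantles_del_vertex]). Only the
    complete subgraphs avoiding [x], that is those of [G - x], remain, and the
    theorem follows by induction along the dismantling sequence of vertices. *)

Set Implicit Arguments.
Unset Strict Implicit.
Unset Printing Implicit Defensive.

Import Order.POrderTheory Order.SetSubsetOrder.

Section PosetDismantling.
Variables (d : Order.disp_t) (U : finPOrderType d).
Implicit Types P Q S : {set U}.

Lemma poset_dismantles_trans P Q S :
  poset_dismantles P Q -> poset_dismantles Q S -> poset_dismantles P S.
Proof.
elim=> // P' Q' p pP' _ IH QS.
exact: poset_dismantles_step pP' (IH QS).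
Qed.

(** This form spares the choice of an explicit deletion order: an extremal
    element of [S :\: Q] is usually the one to delete. *)
Lemma poset_dismantles_greedy P Q :
  Q \subset P ->
  (forall S, Q \subset S -> S \subset P -> S :\: Q != set0 ->
     exists2 p, p \in S :\: Q & poset_dismantlable S p) ->
  poset_dismantles P Q.
Proof.
have [n] := ubnP #|P :\: Q|.
elim: n P => // n IHn P; rewrite ltnS => leDn QP pickP.
have [D0|DN0] := eqVneq (P :\: Q) set0.
  have -> : P = Q.
    by apply/eqP; rewrite eqEsubset QP andbT -setD_eq0 D0.
  exact: poset_dismantles_refl.
have [p pD pdis] := pickP P QP (subxx P) DN0.
have /andP[pQ pP] : (p \notin Q) && (p \in P) by rewrite -in_setD.
apply: poset_dismantles_step pdis _; apply: IHn.
- apply: leq_trans leDn; rewrite setDDl setUC -setDDl.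
  by rewrite [X in _ < X](cardsD1 p) pD.
- by rewrite subsetD1 QP.
- by move=> S QS SP; apply: pickP => //; apply: subset_trans SP (subsetDl _ _).
Qed.

End PosetDismantling.

Section CompleteSubgraphs.
Variable T : finType.
Implicit Types (G H : graph T) (A K L : {set T}) (x a : T).

Lemma ltEsubset K L : (K < L)%O = (K \proper L).
Proof. by rewrite lt_neqAle leEsubset properEneq. Qed.

Lemma complete_posetP G K :
  reflect [/\ K != set0, K \subset vert G &
             forall y z, y \in K -> z \in K -> y != z -> adj G y z]
          (K \in complete_poset G).
Proof.
rewrite inE /complete_in; apply: (iffP and3P) => [[K0 KG Kadj]|[K0 KG Kadj]].
  split=> // y z yK zK; exact/implyP/(forall_inP (forall_inP Kadj y yK)).
split=> //; apply/forall_inP=> y yK; apply/forall_inP=> z zK.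
by apply/implyP; apply: Kadj.
Qed.

Lemma complete_poset_sub G K L :
  K \in complete_poset G -> L \subset K -> L != set0 -> L \in complete_poset G.
Proof.
move=> /complete_posetP[_ KG Kadj] /[dup] LK /subsetP LKin L0.
apply/complete_posetP; split=> // [|y z /LKin yK /LKin zK].
  exact: subset_trans KG.
exact: Kadj.
Qed.

Lemma complete_poset_induced G A :
  complete_poset (induced G A) = [set K in complete_poset G | K \subset A].
Proof.
apply/setP=> K; rewrite [RHS]inE.
apply/complete_posetP/andP=> [[K0]|[/complete_posetP[K0 KG Kadj] KA]].
  rewrite subsetI => /andP[KG KA] Kadj; split=> //.
  apply/complete_posetP; split=> // y z yK zK yz.
  by have /and3P[] := Kadj y z yK zK yz.
split=> //; first by rewrite subsetI KG.
move=> y z yK zK yz.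
by apply/and3P; split; [exact: (subsetP KA)|exact: (subsetP KA)|exact: Kadj].
Qed.

Lemma complete_poset_same G H :
  same_graph G H -> complete_poset G = complete_poset H.
Proof.
case=> eqv eqadj; apply/setP=> K; rewrite !inE /complete_in eqv.
by do 2!congr (_ && _); do 2!apply: eq_forallb_in => ? _; rewrite eqadj.
Qed.

Lemma complete_add_dominating G x a K :
  looped G x -> a \in vert G -> nbhd G x \subset nbhd G a ->
  x \in K -> K \in complete_poset G -> a |: K \in complete_poset G.
Proof.
move=> xx aG /subsetP domx xK /complete_posetP[_ KG Kadj].
have adj_a y : y \in K -> adj G y a.
  move=> yK; have : y \in nbhd G a; last by rewrite inE.
  apply: domx; rewrite inE; have [->//|yx] := eqVneq y x; exact: Kadj.
apply/complete_posetP; split.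
- by apply/set0Pn; exists a; rewrite setU11.
- by rewrite subUset sub1set aG.
- move=> y z /setU1P[->|yK] /setU1P[->|zK] yz.
  + by rewrite eqxx in yz.
  + by rewrite adj_sym adj_a.
  + exact: adj_a.
  + exact: Kadj.
Qed.

(** Deleting a looped dominated vertex: the two sweeps meet at the poset of
    complete subgraphs in which [x] is always accompanied by [a]. *)
Lemma poset_dismantles_del_vertex G x :
  graph_dismantlable G x -> looped G x ->
  poset_dismantles (complete_poset G) [set K in complete_poset G | x \notin K].
Proof.
move=> [xG [a [aG ax domx]]] xx.
pose M := [set K in complete_poset G | (x \in K) ==> (a \in K)].
apply: (@poset_dismantles_trans _ _ _ M).
  apply: poset_dismantles_greedy => [|S MS SG /set0Pn[K0 K0D]].
    by apply/subsetP=> K; rewrite inE => /andP[].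
  have [K KD Kmax] : exists2 K, K \in S :\: M &
      forall L, L \in S :\: M -> #|L| <= #|K|.
    by case: (arg_maxnP (fun K : {set T} => #|K|) K0D) => K; exists K.
  exists K => //; move: (KD); rewrite in_setD inE => /andP[KM KS].
  have KG := subsetP SG K KS.
  move: KM; rewrite KG negb_imply => /andP[xK aK].
  split=> //; left; exists (a |: K).
    rewrite inE ltEsubset properUr ?sub1set // andbT.
    apply: (subsetP MS); rewrite inE setU11 implybT andbT.
    exact: complete_add_dominating xK KG.
  move=> L; rewrite inE ltEsubset => /andP[LS KL].
  rewrite leEsubset subUset sub1set (proper_sub KL) andbT.
  (* If [L] avoided [a], it would be a larger candidate for deletion than [K]. *)
  apply: contraTT (proper_card KL) => aL; rewrite -leqNgt; apply: Kmax.
  rewrite in_setD inE LS andbT (subsetP SG) //= negb_imply aL andbT.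
  by rewrite (subsetP (proper_sub KL)).
pose Q := [set K in complete_poset G | x \notin K].
apply: (@poset_dismantles_greedy _ _ M Q) => [|S QS SM /set0Pn[K0 K0D]].
  by apply/subsetP=> K; rewrite !inE => /andP[-> /negPf->].
have [K KD Kmin] : exists2 K, K \in S :\: Q &
    forall L, L \in S :\: Q -> #|K| <= #|L|.
  by case: (arg_minnP (fun K : {set T} => #|K|) K0D) => K; exists K.
exists K => //; move: (KD); rewrite in_setD inE => /andP[KQ KS].
have := subsetP SM K KS; rewrite inE => /andP[KG xaK].
move: KQ; rewrite KG negbK /= => xK.
have aK : a \in K by rewrite xK in xaK.
split=> //; right; exists (K :\ x).
  rewrite inE ltEsubset properD1 // andbT.
  apply: (subsetP QS); rewrite inE setD11 andbT.
  apply: complete_poset_sub KG (subD1set _ _) _.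
  by apply/set0Pn; exists a; rewrite !inE ax.
move=> L; rewrite inE ltEsubset => /andP[LS LK].
rewrite leEsubset subsetD1 (proper_sub LK) /=.
(* If [L] contained [x], it would be a smaller candidate for deletion than [K]. *)
apply: contraTN (proper_card LK) => xL; rewrite -leqNgt; apply: Kmin.
by rewrite in_setD inE LS xL andbF.
Qed.

Lemma graph_dismantles_complete_poset G H :
  graph_dismantles G H ->
  (forall x, x \in vert G :\: vert H -> looped G x) ->
  poset_dismantles (complete_poset G) (complete_poset H).
Proof.
move=> [[HG _] sameH [s [Us sE sdis]]] loopD.
have -> : complete_poset G = complete_poset (induced G (vert H :|: [set y in s])).
  rewrite complete_poset_induced sE setDE setUIr setUCr setIT (setUidPr HG).
  apply/setP=> K; rewrite [RHS]inE.
  by apply/idP/andP=> [KG|[]//]; split=> //; case/complete_posetP: KG.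
have sD x : x \in s -> x \in vert G :\: vert H by rewrite -sE inE.
rewrite (complete_poset_same sameH).
elim: s Us sdis sD {sE} => [|x s IHs] /=.
  move=> _ _ _.
  have -> : [set y : T in [::]] = set0 by apply/setP=> y; rewrite !inE.
  rewrite setU0; exact: poset_dismantles_refl.
move=> /andP[xs Us] sdis sD.
have xD := sD x (mem_head _ _).
have /andP[xH xG] : (x \notin vert H) && (x \in vert G) by rewrite -in_setD.
set A := vert H :|: _.
have xA : x \in A by rewrite !inE eqxx orbT.
have loopx : looped (induced G A) x.
  by apply/and3P; split=> //; apply: loopD.
have domx := sdis [::] x s erefl.
apply: poset_dismantles_trans (poset_dismantles_del_vertex domx loopx) _.
suff -> : [set K in complete_poset (induced G A) | x \notin K]
          = complete_poset (induced G (vert H :|: [set y in s])).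
  apply: IHs => // [s1 z s2 def_s|z zs]; last by rewrite sD // inE zs orbT.
  by apply: (sdis (x :: s1)); rewrite def_s.
rewrite !complete_poset_induced.
have -> : vert H :|: [set y in s] = A :\ x.
  apply/setP=> y; rewrite !inE.
  by have [->|] := eqVneq y x; rewrite ?(negPf xH) ?(negPf xs).
by apply/setP=> K; rewrite inE [in LHS]inE [in RHS]inE subsetD1 andbA.
Qed.

End CompleteSubgraphs.

Theorem theorem3p2 (T : finType) (G H : graph T) (subHG : subgraph H G) :
  (graph_dismantles G H ->
   (forall x, x \in vert G :\: vert H -> looped G x) ->
   poset_dismantles (complete_poset G) (complete_poset H))
  /\
  (reflexive_graph G ->
   graph_dismantles G H ->
   poset_dismantles (complete_poset G) (complete_poset H)).
Proof.
split; first exact: graph_dismantles_complete_poset.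
move=> reflG GH; apply: graph_dismantles_complete_poset => // x.
by rewrite inE => /andP[_]; apply: reflG.
Qed.
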